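(* There exists a flag triangulation $\Gamma$ of a seven-dimensional simplex $2^V$ (so $|V|=8$) such that the local $h$-polynomial $\ell_V(\Gamma,x)$ is not real-rooted (i.e., has a non-real complex root).
   Context: A triangulation of the simplex $2^V$ is (the abstract simplicial complex of) a geometric simplicial complex whose simplices are each contained in a geometric simplex $\Sigma$ with vertex set $V$ and whose union is $\Sigma$. For $F\subseteq V$, the restriction $\Gamma_F$ is the subcomplex of simplices contained in the face $\mathrm{conv}(F)$ of $\Sigma$; it is a triangulation of $2^F$, regarded as $(|F|-1)$-dimensional. A simplicial complex is flag if every set of vertices pairwise joined by edges is a face. The $h$-polynomial of a $(d-1)$-dimensional simplicial complex $\Delta$ is $h(\Delta,x)=\sum_{i=0}^d f_{i-1}(\Delta)x^i(1-x)^{d-i}$, $f_i$ being the number of $i$-dimensional faces ($f_{-1}=1$). The local $h$-polynomial is $\ell_V(\Gamma,x)=\sum_{F\subseteq V}(-1)^{|V|-|F|}h(\Gamma_F,x)$. *)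

(* Defs.v *)
From HB Require Import structures.
From mathcomp Require Import all_boot all_order all_algebra.
From mathcomp Require Import boolp classical_sets reals.
From mathcomp Require Import complex.

Set Implicit Arguments.
Unset Strict Implicit.
Unset Printing Implicit Defensive.

Import Order.TTheory GRing.Theory Num.Theory.

Local Open Scope ring_scope.

Section AbstractComplexes.
Context {W : finType}.
Implicit Types (D : {set {set W}}) (S T : {set W}).

                                                                             
                                                     
Definition simplicial_complex D : Prop :=
  finset.set0 \in D /\ (forall S T, S \in D -> T \subset S -> T \in D).

Definition flag D : Prop :=
  forall S, (forall u, u \in S -> [set u]%SET \in D) ->
    (forall u v, u \in S -> v \in S -> u != v -> [set u; v]%SET \in D) ->
    S \in D.

                                                                     
Definition nfaces D (i : nat) : nat := #|[set S in D | #|S| == i]%SET|.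

                                           
Definition hpoly (d : nat) D : {poly int} :=
  \sum_(i < d.+1) (nfaces D i)%:R * 'X^i * (1 - 'X) ^+ (d - i).

End AbstractComplexes.

Section Geometry.
Context {R : realType} {n : nat} {W : finType}.
Variable pos : W -> 'rV[R]_n.

Definition conv_hull (S : {set W}) : set 'rV[R]_n :=
  [set x | exists c : W -> R,
     [/\ forall w, w \in S -> 0 <= c w,
         \sum_(w in S) c w = 1
       & x = \sum_(w in S) c w *: pos w]]%classic.

Definition affinely_independent (S : {set W}) : Prop :=
  forall c : W -> R, \sum_(w in S) c w = 0 ->
    \sum_(w in S) c w *: pos w = 0 -> forall w, w \in S -> c w = 0.

                                                                          
                                                
Definition geometric_complex (D : {set {set W}}) : Prop :=
  [/\ simplicial_complex D,
      forall S, S \in D -> affinely_independent S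
    & forall S T, S \in D -> T \in D ->
        exists U : {set W}, [/\ U \subset S, U \subset T
          & (conv_hull S `&` conv_hull T)%classic = conv_hull U]].

End Geometry.

Record triangulation (R : realType) (V : finType) := Triangulation {
  tri_dim : nat;
  tri_corner : V -> 'rV[R]_tri_dim;
  tri_corner_indep : affinely_independent tri_corner [set: V]%SET;
  tri_vertex : finType;
  tri_pos : tri_vertex -> 'rV[R]_tri_dim;
  tri_faces : {set {set tri_vertex}};
  tri_geometric : geometric_complex tri_pos tri_faces;
  tri_union : (\bigcup_(S in [set S | S \in tri_faces]) conv_hull tri_pos S
               = conv_hull tri_corner [set: V]%SET)%classic
}.

Section LocalH.
Context {R : realType} {V : finType}.
Variable G : triangulation R V.

Definition restriction (F : {set V}) : {set {set tri_vertex G}} :=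
  [set S in tri_faces G |
    `[< (conv_hull (@tri_pos _ _ G) S
          `<=` conv_hull (@tri_corner _ _ G) F)%classic >]]%SET.

Definition local_hpoly : {poly int} :=
  \sum_(F : {set V}) (-1) ^+ (#|V| - #|F|) * hpoly #|F| (restriction F).

End LocalH.

                                                       
Definition real_rooted (R : realType) (p : {poly int}) : Prop :=
  p = 0 \/
  forall z : R[i], root (map_poly (intr : int -> R[i]) p) z -> complex.Im z = 0.

(* Main.v *)
(** The triangulation comes from a full binary tree whose leaves are the corners
    of the simplex.  Every node becomes a vertex, placed at the barycenter of the
    leaves below it, and a set of nodes is a face unless it contains two siblings,
    so the complex is flag.  A point [x] of the simplex is a combination of the
    nodes in which siblings never both occur in exactly one way, because the sum of
    the (rescaled) coefficients from the root down to a node [w] must be the minimum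
    of the coordinates of [x] over the leaves below [w]; this makes the complex a
    triangulation.
    Let [H] be the h-polynomial and [L] the local h-polynomial.  Proper faces of the
    simplex of [Node l r] are triangulated by joins, whereas the whole simplex is
    triangulated by a cone over the join, amalgamated with a pair of points, of the
    complexes of [l] and [r] without their roots.  Hence
    [H (Node l r) = (1 + X) * H l * H r] and
    [L (Node l r) = L l * L r + X * H l * H r].
    For the caterpillar made of four cherries, [L] is
    [X * ((1 + X)^2 + X) * ((1 + X)^4 + X^2)], and the last factor has no real root. *)

Require Import Defs.
From mathcomp Require Import boolp classical_sets reals complex.
From mathcomp Require Import all_boot all_order all_algebra.
From mathcomp Require Import ring lra zify.

Set Implicit Arguments.
Unset Strict Implicit.
Unset Printing Implicit Defensive.

Import Order.TTheory GRing.Theory Num.Theory.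

(** * Binary trees and the complex of node sets without siblings *)

Inductive tree := Leaf | Node of tree & tree.

Fixpoint leaves (t : tree) : finType :=
  if t is Node l r then (leaves l + leaves r)%type else unit.

Fixpoint below (t : tree) : finType :=
  if t is Node l r then (option (below l) + option (below r))%type else void.

(* The root is [None], so that it is available without a case analysis on [t]. *)
Notation nodes t := (option (below t)).

Fixpoint under (t : tree) : nodes t -> pred (leaves t) :=
  match t return nodes t -> pred (leaves t) with
  | Leaf => fun _ _ => true
  | Node l r => fun w v =>
      match w, v with
      | None, _ => true
      | Some (inl a), inl x => under a x
      | Some (inr b), inr x => under b x
      | _, _ => false
      end
  end.

(** Across the two subtrees only the two children [Some (inl None)] and [Some (inr None)] are
    siblings; [~~ isSome a && ~~ isSome b] detects that both nodes are roots of their subtrees. *)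
Fixpoint sibling (t : tree) : rel (nodes t) :=
  match t return rel (nodes t) with
  | Leaf => fun _ _ => false
  | Node l r => fun u w =>
      match u, w with
      | Some (inl a), Some (inl b) => sibling a b
      | Some (inr a), Some (inr b) => sibling a b
      | Some (inl a), Some (inr b) => ~~ isSome a && ~~ isSome b
      | Some (inr a), Some (inl b) => ~~ isSome a && ~~ isSome b
      | _, _ => false
      end
  end.

Definition face (t : tree) (S : {set nodes t}) : bool :=
  [forall u in S, forall w in S, ~~ sibling u w].

Definition faces (t : tree) : {set {set nodes t}} := [set S | face S].

Lemma under_root t v : under (None : nodes t) v.
Proof. by case: t v. Qed.

Lemma under_nonempty t (w : nodes t) : exists v, under w v.
Proof.
elim: t w => [|l IHl r IHr] w; first by exists tt.
case: w => [[a|b]|].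
- by have [v av] := IHl a; exists (inl v).
- by have [v bv] := IHr b; exists (inr v).
- by have [v _] := IHl None; exists (inl v).
Qed.

Lemma sibling_rootl t (w : nodes t) : sibling None w = false.
Proof. by case: t w. Qed.

Lemma sibling_rootr t (w : nodes t) : sibling w None = false.
Proof. by case: t w => [|l r] //= [[[a|]|[b|]]|]. Qed.

Lemma sibling_irr t (w : nodes t) : sibling w w = false.
Proof. by elim: t w => [//|l IHl r IHr] [[[a|]|[b|]]|] //=. Qed.

Lemma faceP t (S : {set nodes t}) :
  reflect (forall u w, u \in S -> w \in S -> ~~ sibling u w) (face S).
Proof.
apply: (iffP forall_inP) => [fS u w uS wS | fS u uS].
  by move/forall_inP: (fS u uS); apply.
by apply/forall_inP => w; apply: fS.
Qed.

Lemma faces_complex t : simplicial_complex (faces t).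
Proof.
split=> [|S T]; first by rewrite inE; apply/faceP => u w; rewrite inE.
rewrite !inE => /faceP fS /subsetP TS; apply/faceP => u w uT wT.
by apply: fS; apply: TS.
Qed.

(** Faces are the independent sets of the sibling graph, so membership is decided on pairs. *)
Lemma faces_flag t : flag (faces t).
Proof.
move=> S _ S2; rewrite inE; apply/faceP => u w uS wS.
have [<-|uw] := eqVneq u w; first by rewrite sibling_irr.
have := S2 u w uS wS uw; rewrite inE => /faceP; apply; rewrite !inE eqxx //.
by rewrite orbT.
Qed.

Lemma big_option (M : Type) (idx : M) (op : Monoid.com_law idx) (T : finType)
    (P : pred (option T)) (f : option T -> M) :
  \big[op/idx]_(w | P w) f w =
  op (if P None then f None else idx) (\big[op/idx]_(a | P (Some a)) f (Some a)).
Proof.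
rewrite big_mkcond (bigD1 None) //=; congr (op _ _).
rewrite [RHS]big_mkcond /= (reindex_omap Some id) /=; last by case.
by apply: eq_big => [a|//]; rewrite eqxx.
Qed.

(** * Existence and uniqueness of sibling-free coordinates *)

Section Coordinates.
Variable R : realFieldType.
Local Open Scope ring_scope.

(** The nodes above a leaf form the path to it from the root. This is the [v]-coordinate of the
    combination, with coefficients [c], of the indicator vectors of the leaf sets below the
    nodes. *)
Definition leaf_sum t (c : nodes t -> R) (v : leaves t) : R :=
  \sum_(w | under w v) c w.

Definition reduced t (c : nodes t -> R) : Prop :=
  (forall w, 0 <= c w) /\ (forall u w, sibling u w -> c u = 0 \/ c w = 0).

(** Pushing the coefficient of a parent into the root of a subtree preserves the leaf sums there,
    which makes induction on the tree possible. *)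
Definition shift_root t (c : nodes t -> R) (s : R) (w : nodes t) : R :=
  c w + (if w is None then s else 0).

Lemma leaf_sum_shift_root t (c : nodes t -> R) s v :
  leaf_sum (shift_root c s) v = leaf_sum c v + s.
Proof.
rewrite /leaf_sum big_split /=; congr (_ + _).
by rewrite big_option /= under_root big1_eq addr0.
Qed.

Lemma leaf_sum_inl l r (c : nodes (Node l r) -> R) v :
  leaf_sum c (inl v) = leaf_sum (c \o Some \o inl) v + c None.
Proof.
by rewrite /leaf_sum big_option big_sumType /= big_pred0_eq addr0 addrC.
Qed.

Lemma leaf_sum_inr l r (c : nodes (Node l r) -> R) v :
  leaf_sum c (inr v) = leaf_sum (c \o Some \o inr) v + c None.
Proof.
by rewrite /leaf_sum big_option big_sumType /= big_pred0_eq add0r addrC.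
Qed.

Lemma reduced_shift_root t (c : nodes t -> R) s :
  reduced c -> 0 <= c None + s -> reduced (shift_root c s).
Proof.
move=> [c0 cs] s0; split=> [[b|] //|[u|] [w|]]; rewrite /shift_root ?addr0;
  rewrite ?sibling_rootl ?sibling_rootr //.
exact: cs.
Qed.

Lemma reduced_inl l r (c : nodes (Node l r) -> R) :
  reduced c -> reduced (shift_root (c \o Some \o inl) (c None)).
Proof.
move=> [c0 cs]; apply: reduced_shift_root; last exact: (addr_ge0 (c0 _) (c0 _)).
by split=> [w|u w]; [exact: c0 | exact: (cs (Some (inl u)) (Some (inl w)))].
Qed.

Lemma reduced_inr l r (c : nodes (Node l r) -> R) :
  reduced c -> reduced (shift_root (c \o Some \o inr) (c None)).
Proof.
move=> [c0 cs]; apply: reduced_shift_root; last exact: (addr_ge0 (c0 _) (c0 _)).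
by split=> [w|u w]; [exact: c0 | exact: (cs (Some (inr u)) (Some (inr w)))].
Qed.

(* The coefficient of a node is the increment, from its parent to itself, of
   the minimum of [x] over the leaves below; siblings compete for the minimum
   at their parent, so one of the two increments vanishes. *)
Lemma reduced_exists t (x : leaves t -> R) :
  (forall v, 0 <= x v) -> exists2 c, reduced c & forall v, leaf_sum c v = x v.
Proof.
elim: t x => [|l IHl r IHr] x x0.
  exists (fun=> x tt); first by split.
  by case; rewrite /leaf_sum big_option /= big_pred0 ?addr0 // => -[].
have [a [a0 asib] ax] := IHl (x \o inl) (fun v => x0 (inl v)).
have [b [b0 bsib] bx] := IHr (x \o inr) (fun v => x0 (inr v)).
pose m := Order.min (a None) (b None).
have ma : 0 <= a None - m by rewrite subr_ge0 ge_min lexx.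
have mb : 0 <= b None - m by rewrite subr_ge0 ge_min lexx orbT.
have m0 : 0 <= m by rewrite le_min a0 b0.
have [a'0 a'sib] : reduced (shift_root a (- m)) by apply: reduced_shift_root.
have [b'0 b'sib] : reduced (shift_root b (- m)) by apply: reduced_shift_root.
have mab : a None - m = 0 \/ b None - m = 0.
  by rewrite /m; case: leP => _; [left|right]; rewrite subrr.
pose c (w : nodes (Node l r)) := match w with
  | Some (inl u) => shift_root a (- m) u
  | Some (inr u) => shift_root b (- m) u
  | None => m end.
exists c.
  split=> [[[u|u]|] //|]; [exact: a'0 | exact: b'0 |].
  move=> [[u|u]|] [[w|w]|] //=; [exact: a'sib| | |exact: b'sib].
    by case: u; case: w.
  by case: u; case: w => // _; apply/or_comm.
case=> v; rewrite ?leaf_sum_inl ?leaf_sum_inr.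
  by rewrite [X in X + _](leaf_sum_shift_root a) ax /= subrK.
by rewrite [X in X + _](leaf_sum_shift_root b) bx /= subrK.
Qed.

(** This injectivity yields both the independence of the vertices of a face and the intersection
    property of faces. *)
Lemma reduced_unique t (c d : nodes t -> R) :
  reduced c -> reduced d -> leaf_sum c =1 leaf_sum d -> c =1 d.
Proof.
elim: t c d => [|l IHl r IHr] c d cC dC cd.
  have V f : \sum_(a : void) f a = 0 :> R by apply: big_pred0; case.
  by move=> [[]|]; have := cd tt; rewrite /leaf_sum !big_option /= !V !addr0.
have L : shift_root (c \o Some \o inl) (c None) =1 shift_root (d \o Some \o inl) (d None).
  apply: IHl => [||v]; rewrite ?leaf_sum_shift_root -?leaf_sum_inl //;
  exact: reduced_inl.
have M : shift_root (c \o Some \o inr) (c None) =1 shift_root (d \o Some \o inr) (d None).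
  apply: IHr => [||v]; rewrite ?leaf_sum_shift_root -?leaf_sum_inr //;
  exact: reduced_inr.
case: cC dC => [c0 cs] [d0 ds].
have := L None; have := M None; rewrite /shift_root /= => M0 L0.
have cn := cs (Some (inl None)) (Some (inr None)) isT.
have dn := ds (Some (inl None)) (Some (inr None)) isT.
(* One child has coefficient zero and the other a nonnegative one, so each root coefficient is the
   minimum of the same two sums [L0] and [M0]. *)
have E : c None = d None.
  have := c0 (Some (inl None)); have := c0 (Some (inr None)).
  have := d0 (Some (inl None)); have := d0 (Some (inr None)).
  by move: M0 L0; case: cn => ->; case: dn => ->; lra.
move=> [[[a|]|[b|]]|] //.
- by have := L (Some a); rewrite /shift_root /= !addr0.
- by move: L0; rewrite E => /addIr.
- by have := M (Some b); rewrite /shift_root /= !addr0.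
- by move: M0; rewrite E => /addIr.
Qed.

End Coordinates.

(** * The geometric realization by barycenters *)

Section Geometry.
Variables (R : realType) (t : tree).
Local Open Scope ring_scope.

Definition corner (v : leaves t) : 'rV[R]_#|leaves t| :=
  delta_mx 0 (enum_rank v).

Definition barycenter (w : nodes t) : 'rV[R]_#|leaves t| :=
  \row_j (if under w (enum_val j) then #|under w|%:R^-1 else 0).

(** Division by the number of leaves below turns coefficients of barycenters into coefficients of
    indicator vectors. The value zero off [S] lets combinations on different faces be compared as
    functions on all nodes. *)
Definition scaled (S : {set nodes t}) (c : nodes t -> R) (w : nodes t) : R :=
  if w \in S then c w / #|under w|%:R else 0.

Lemma under_gt0 (w : nodes t) : 0 < #|under w|%:R :> R.
Proof.
by rewrite ltr0n; apply/card_gt0P; have [v wv] := under_nonempty w; exists v.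
Qed.

Lemma under_neq0 (w : nodes t) : #|under w|%:R != 0 :> R.
Proof. exact: lt0r_neq0 (under_gt0 w). Qed.

Lemma row_leafP (x y : 'rV[R]_#|leaves t|) :
  (forall v, x 0 (enum_rank v) = y 0 (enum_rank v)) -> x = y.
Proof. by move=> xy; apply/rowP => j; rewrite -(enum_valK j). Qed.

Lemma comb_cornerE (F : {set leaves t}) (c : leaves t -> R) v :
  (\sum_(u in F) c u *: corner u) 0 (enum_rank v) = if v \in F then c v else 0.
Proof.
rewrite summxE big_mkcond (bigD1 v) //= big1 ?addr0.
  by rewrite !mxE !eqxx /= mulr1.
move=> u uv; case: ifP => // _; rewrite !mxE eqxx /=.
by rewrite (inj_eq enum_rank_inj) eq_sym (negPf uv) mulr0.
Qed.

Lemma comb_barycenterE (S : {set nodes t}) (c : nodes t -> R) v :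
  (\sum_(w in S) c w *: barycenter w) 0 (enum_rank v) = leaf_sum (scaled S c) v.
Proof.
rewrite summxE /leaf_sum big_mkcond [RHS]big_mkcond; apply: eq_bigr => w _.
rewrite /scaled !mxE enum_rankK.
by case: (w \in S); case: (under w v); rewrite ?mulr0.
Qed.

Lemma leaf_sum_total (c : nodes t -> R) :
  \sum_v leaf_sum c v = \sum_w c w * #|under w|%:R.
Proof.
rewrite /leaf_sum; under eq_bigr do rewrite big_mkcond.
rewrite exchange_big; apply: eq_bigr => w _.
by rewrite -big_mkcond sumr_const mulr_natr.
Qed.

(** The coordinates of a barycenter sum to one, so a convex combination keeps total mass one. *)
Lemma sum_scaled (S : {set nodes t}) (c : nodes t -> R) :
  \sum_v leaf_sum (scaled S c) v = \sum_(w in S) c w.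
Proof.
rewrite leaf_sum_total [RHS]big_mkcond; apply: eq_bigr => w _.
by rewrite /scaled; case: ifP => _; rewrite ?mul0r // divfK // under_neq0.
Qed.

Lemma reduced_scaled (S : {set nodes t}) (c : nodes t -> R) :
  face S -> (forall w, w \in S -> 0 <= c w) -> reduced (scaled S c).
Proof.
move=> /faceP fS c0; split=> [w|u w uw]; rewrite /scaled.
  by case: ifP => // /c0 cw; rewrite divr_ge0 // ler0n.
case: ifP => [uS|]; last by left.
case: ifP => [wS|]; last by right.
by move: (fS u w uS wS); rewrite uw.
Qed.

Lemma scaled_inj (S : {set nodes t}) (c d : nodes t -> R) w :
  w \in S -> scaled S c w = scaled S d w -> c w = d w.
Proof.
by move=> wS; rewrite /scaled wS; apply: mulIf; rewrite invr_neq0 ?under_neq0.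
Qed.

Lemma corner_hullP (F : {set leaves t}) x :
  conv_hull corner F x <->
  [/\ forall v, 0 <= x 0 (enum_rank v), \sum_v x 0 (enum_rank v) = 1
    & forall v, v \notin F -> x 0 (enum_rank v) = 0].
Proof.
split=> [[c [c0 c1 ->]] | [x0 x1 xF]].
  split=> [v||v vF]; rewrite ?comb_cornerE.
  - by case: ifP => // /c0.
  - by under eq_bigr do rewrite comb_cornerE; rewrite -big_mkcond.
  - by rewrite (negPf vF).
exists (fun v => x 0 (enum_rank v)); split=> //.
  by rewrite -x1 big_mkcond; apply: eq_bigr => v _; case: ifPn => // /xF.
by apply: row_leafP => v; rewrite comb_cornerE; case: ifPn => // /xF.
Qed.

Lemma corner_independent : affinely_independent corner [set: leaves t]%SET.
Proof.
move=> c _ /rowP c0 v _; have := c0 (enum_rank v).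
by rewrite comb_cornerE in_setT !mxE.
Qed.

Lemma barycenter_hull (S : {set nodes t}) w :
  w \in S -> conv_hull barycenter S (barycenter w).
Proof.
move=> wS; exists (fun u => (u == w)%:R); split=> [u _||].
- exact: ler0n.
- by rewrite (bigD1 w) //= eqxx big1 ?addr0 // => u /andP[_ /negPf->].
- rewrite (bigD1 w) //= eqxx scale1r big1 ?addr0 // => u /andP[_ /negPf->].
  by rewrite scale0r.
Qed.

(** It suffices to test the vertices, and a barycenter is positive exactly at the leaves below its
    node. This makes restriction to a face of the simplex combinatorial. *)
Lemma hull_sub_cornerP (S : {set nodes t}) (F : {set leaves t}) :
  (conv_hull barycenter S `<=` conv_hull corner F)%classic <->
  (forall w v, w \in S -> under w v -> v \in F).
Proof.
split=> [SF w v wS wv | SF x [c [c0 c1 ->]]].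
  have /corner_hullP[_ _ wF] := SF _ (barycenter_hull wS).
  apply: contraTT (wv) => /wF; rewrite !mxE enum_rankK wv => /eqP.
  by rewrite invr_eq0 (negPf (under_neq0 w)).
apply/corner_hullP; split=> [v||v vF]; rewrite ?comb_barycenterE.
- apply: sumr_ge0 => w _; rewrite /scaled; case: ifP => // /c0 cw.
  by rewrite divr_ge0 // ler0n.
- by under eq_bigr do rewrite comb_barycenterE; rewrite sum_scaled.
- apply: big1 => w wv; rewrite /scaled; case: ifP => // wS.
  by rewrite (SF w v wS wv) in vF.
Qed.

Lemma conv_hull_sub (S T : {set nodes t}) :
  S \subset T -> (conv_hull barycenter S `<=` conv_hull barycenter T)%classic.
Proof.
move=> /subsetP ST x [c [c0 c1 ->]].
exists (fun w => if w \in S then c w else 0); split.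
- by move=> w _; case: ifP => // /c0.
- rewrite -big_mkcondr -c1; apply: eq_bigl => w.
  by apply/andP/idP => [[]//|wS]; split=> //; apply: ST.
- rewrite big_mkcond [RHS]big_mkcond /=; apply: eq_bigr => w _.
  case: (boolP (w \in S)) => [wS|_]; first by rewrite (ST w wS).
  by rewrite scale0r if_same.
Qed.

Lemma barycenter_independent (S : {set nodes t}) :
  face S -> affinely_independent barycenter S.
Proof.
move=> fS c _ c0 w wS.
(* The positive and negative parts of a relation are reduced once scaled and have equal leaf sums,
   so uniqueness identifies them. *)
pose p u := Num.max (c u) 0; pose q u := Num.max (- c u) 0.
have cpq u : c u = p u - q u.
  by rewrite /p /q; case: (leP (c u) 0); case: (leP (- c u) 0); lra.
have pq : scaled S p =1 scaled S q.
  apply: reduced_unique => [||v].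
  - by apply: reduced_scaled => // u _; rewrite /p le_max lexx orbT.
  - by apply: reduced_scaled => // u _; rewrite /q le_max lexx orbT.
  rewrite -!comb_barycenterE; apply/eqP; rewrite -subr_eq0; apply/eqP.
  move/rowP/(_ (enum_rank v)): c0; rewrite !mxE summxE => <-.
  rewrite !summxE -sumrB; apply: eq_bigr => u _.
  by rewrite [in RHS]cpq scalerBl !mxE.
by rewrite cpq (scaled_inj wS (pq w)) subrr.
Qed.

(** A point common to two hulls has two reduced representations; by uniqueness they agree, so both
    are supported on [S :&: T]. *)
Lemma barycenter_geometric : geometric_complex barycenter (faces t).
Proof.
split=> [|S|S T]; rewrite ?inE; first exact: faces_complex.
  exact: barycenter_independent.
move=> fS fT; exists (S :&: T)%SET; split; rewrite ?subsetIl ?subsetIr //.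
apply/seteqP; split=> [x [[c [c0 c1 xc]] [d [d0 d1 xd]]]|x xST]; last first.
  by split; apply: conv_hull_sub xST; rewrite ?subsetIl ?subsetIr.
have cd : scaled S c =1 scaled T d.
  apply: reduced_unique => [||v]; try exact: reduced_scaled.
  by rewrite -!comb_barycenterE -xc -xd.
have cST w : w \in S -> w \notin T -> c w = 0.
  move=> wS wT; have := cd w; rewrite /scaled wS (negPf wT) => /eqP.
  by rewrite mulf_eq0 invr_eq0 (negPf (under_neq0 w)) orbF => /eqP.
exists c; split=> [w||].
- by rewrite inE => /andP[/c0].
- rewrite -c1 big_mkcond [RHS]big_mkcond; apply: eq_bigr => w _; rewrite inE.
  by case: (boolP (w \in S)) => //= wS; case: ifPn => // /(cST w wS).
- rewrite xc big_mkcond [RHS]big_mkcond; apply: eq_bigr => w _; rewrite inE.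
  case: (boolP (w \in S)) => //= wS; case: ifPn => // /(cST w wS) ->.
  by rewrite scale0r.
Qed.

Lemma barycenter_union :
  (\bigcup_(S in [set S | S \in faces t]) conv_hull barycenter S
   = conv_hull corner [set: leaves t]%SET)%classic.
Proof.
apply/seteqP; split=> [x [S _]|x /corner_hullP[x0 x1 _]].
  by move: x; apply/hull_sub_cornerP => w v _ _; rewrite in_setT.
have [c [c0 cs] cx] := reduced_exists x0.
(* The support of reduced coordinates contains no two siblings, hence is a face; [d] undoes the
   scaling. *)
pose S := [set w | c w != 0]%SET; pose d w := c w * #|under w|%:R.
have dS w : scaled S d w = c w.
  rewrite /scaled /d inE; case: eqP => [->//|_].
  by rewrite mulfK // under_neq0.
exists S.
  rewrite /= inE; apply/faceP => u w; rewrite !inE => uS wS; apply/negP => /cs.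
  by case=> /eqP; apply/negP.
exists d; split=> [w _||].
- by rewrite mulr_ge0 // ler0n.
- by rewrite -sum_scaled -x1; apply: eq_bigr => v _; rewrite -cx; apply: eq_bigr.
- by apply: row_leafP => v; rewrite comb_barycenterE -cx; apply: eq_bigr.
Qed.

Definition tree_triangulation : triangulation R (leaves t) :=
  Triangulation corner_independent barycenter_geometric barycenter_union.

End Geometry.

(** * Decomposition of faces and restrictions at an inner node *)

Section Counting.
Local Open Scope ring_scope.

Definition sum_set (T1 T2 : finType) (A : {set T1}) (B : {set T2}) : {set T1 + T2} :=
  [set x | match x with inl a => a \in A | inr b => b \in B end]%SET.

Definition node_set l r (o : bool) (A : {set nodes l}) (B : {set nodes r}) :
    {set nodes (Node l r)} :=
  [set w : nodes (Node l r) |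
    match w with
    | None => o
    | Some (inl a) => a \in A
    | Some (inr b) => b \in B
    end]%SET.

Lemma card_sum_set (T1 T2 : finType) (A : {set T1}) (B : {set T2}) :
  #|sum_set A B| = (#|A| + #|B|)%N.
Proof.
rewrite -!sum1_card big_sumType /=.
by congr addn; apply: eq_bigl => x; rewrite inE.
Qed.

Lemma card_node_set l r o (A : {set nodes l}) (B : {set nodes r}) :
  #|node_set o A B| = (o + (#|A| + #|B|))%N.
Proof.
rewrite -!sum1_card big_option big_sumType /= inE.
by congr (_ + (_ + _))%N; apply: eq_bigl => x; rewrite inE.
Qed.

Lemma sum_set_eqT (T1 T2 : finType) (A : {set T1}) (B : {set T2}) :
  (sum_set A B == [set: T1 + T2]%SET) = (A == [set: T1]%SET) && (B == [set: T2]%SET).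
Proof.
apply/eqP/andP => [/setP AB|[/eqP-> /eqP->]].
  split; apply/eqP/setP => x.
    by have := AB (inl x); rewrite !inE.
  by have := AB (inr x); rewrite !inE.
by apply/setP => -[x|x]; rewrite !inE.
Qed.

Lemma big_sum_set (M : nmodType) (T1 T2 : finType) (f : {set T1 + T2} -> M) :
  \sum_F f F = \sum_A \sum_B f (sum_set A B).
Proof.
rewrite pair_big /= (reindex (fun p => sum_set p.1 p.2)) //=.
exists (fun F : {set T1 + T2} => ([set a | inl a \in F], [set b | inr b \in F])%SET).
  by move=> [A B] _; congr pair; apply/setP => x; rewrite !inE.
by move=> F _; apply/setP => -[x|x]; rewrite !inE.
Qed.

Lemma big_node_set (M : nmodType) l r (P : pred {set nodes (Node l r)})
    (f : {set nodes (Node l r)} -> M) :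
  \sum_(S | P S) f S =
  \sum_o \sum_A \sum_(B | P (node_set o A B)) f (node_set o A B).
Proof.
rewrite big_mkcond; under [RHS]eq_bigr do under eq_bigr do rewrite big_mkcond.
rewrite pair_big /= pair_big /=.
rewrite (reindex (fun p : bool * {set nodes l} * {set nodes r} =>
  node_set p.1.1 p.1.2 p.2)) //=.
exists (fun S : {set nodes (Node l r)} =>
  (None \in S, [set a | Some (inl a) \in S], [set b | Some (inr b) \in S])%SET).
  move=> [[o A] B] _; rewrite inE; congr (_, _, _); apply/setP => x; rewrite !inE //.
by move=> S _; apply/setP => -[[x|x]|]; rewrite !inE.
Qed.

Definition carried t (F : {set leaves t}) (S : {set nodes t}) : bool :=
  [forall w in S, [forall v, under w v ==> (v \in F)]].

Lemma carriedP t (F : {set leaves t}) (S : {set nodes t}) :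
  reflect (forall w v, w \in S -> under w v -> v \in F) (carried F S).
Proof.
apply: (iffP forall_inP) => [SF w v wS wv | SF w wS].
  by have /forallP/(_ v)/implyP := SF w wS; apply.
by apply/forallP => v; apply/implyP; apply: SF.
Qed.

(** The only sibling pair not inside a subtree consists of the two subtree roots. *)
Lemma face_node_set l r o (A : {set nodes l}) (B : {set nodes r}) :
  face (node_set o A B) = [&& face A, face B & ~~ ((None \in A) && (None \in B))].
Proof.
apply/faceP/and3P => [fS|[/faceP fA /faceP fB AB]].
  split; [apply/faceP => u w uA wA|apply/faceP => u w uB wB|apply/negP => /andP[nA nB]].
  - by apply: (fS (Some (inl u)) (Some (inl w))); rewrite inE.
  - by apply: (fS (Some (inr u)) (Some (inr w))); rewrite inE.
  - by have := fS (Some (inl None)) (Some (inr None)); rewrite !inE; move/(_ nA nB).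
move=> [[u|u]|] [[w|w]|] //; rewrite !inE => uS wS; [exact: fA| | |exact: fB].
  by apply: contra AB; case: u w uS wS => [?|] [?|] //= -> ->.
by apply: contra AB; case: u w uS wS => [?|] [?|] //= -> ->.
Qed.

(** The root lies above every leaf, so only the whole simplex carries it. *)
Lemma carried_node_set l r (F1 : {set leaves l}) (F2 : {set leaves r}) o A B :
  carried (t := Node l r) (sum_set F1 F2) (node_set o A B) =
  [&& o ==> (sum_set F1 F2 == [set: leaves l + leaves r]%SET),
      carried F1 A & carried F2 B].
Proof.
apply/carriedP/and3P => [SF|[oF /carriedP AF /carriedP BF]].
  split.
  - apply/implyP => o1; apply/eqP/setP => v; rewrite [RHS]inE.
    by apply: (SF None v) => //; rewrite inE.
  - by apply/carriedP => w v wA wv;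
    have := SF (Some (inl w)) (inl v); rewrite !inE; apply.
  - by apply/carriedP => w v wB wv;
    have := SF (Some (inr w)) (inr v); rewrite !inE; apply.
move=> [[w|w]|] v; rewrite inE.
- by case: v => v // wA wv; rewrite inE; apply: AF wv.
- by case: v => v // wA wv; rewrite inE; apply: BF wv.
- by move=> o1 _; move: oF; rewrite o1 => /eqP->; rewrite inE.
Qed.

Lemma carriedT t (S : {set nodes t}) : carried [set: leaves t]%SET S.
Proof. by apply/carriedP => w v _ _; rewrite inE. Qed.

Lemma carried_root t (F : {set leaves t}) (S : {set nodes t}) :
  None \in S -> carried F S -> F = [set: leaves t]%SET.
Proof.
move=> nS /carriedP SF; apply/setP => v; rewrite [RHS]inE.
exact: SF nS (under_root v).
Qed.

Lemma node_setE l r (S : {set nodes (Node l r)}) :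
  S = node_set (None \in S) [set a | Some (inl a) \in S]%SET
        [set b | Some (inr b) \in S]%SET.
Proof. by apply/setP => -[[x|x]|]; rewrite !inE. Qed.

Lemma card_leaves_node l r : #|leaves (Node l r)| = (#|leaves l| + #|leaves r|)%N.
Proof. exact: card_sum. Qed.

(** At an inner node at most one of the two subtree roots is present, so adding the bounds for the
    subtrees leaves room for one more vertex only if the root occurs. *)
Lemma card_face t (S : {set nodes t}) :
  face S -> (#|S| < #|leaves t| + (None \in S))%N.
Proof.
elim: t S => [|l IHl r IHr] S.
  move=> _; rewrite -sum1_card big_option /= card_unit big_pred0; last by case.
  by rewrite addn0; case: ifP.
rewrite (node_setE S); move: (None \in S) [set a | _]%SET [set b | _]%SET => o A B.
rewrite face_node_set card_node_set card_leaves_node inE => /and3P[/IHl + /IHr +].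
by case: (None \in A); case: (None \in B) => //=; lia.
Qed.

Lemma card_carried t (F : {set leaves t}) (S : {set nodes t}) :
  face S -> carried F S -> (#|S| <= #|F|)%N.
Proof.
elim: t F S => [|l IHl r IHr] F S fS SF.
  have := card_face fS; case: (boolP (None \in S)) => [nS|_].
    by rewrite (carried_root nS SF) cardsT addn1 ltnS.
  by rewrite addn0 card_unit ltnS leqn0 => /eqP->.
have := card_face fS; case: (boolP (None \in S)) => [nS|nS _].
  by rewrite (carried_root nS SF) cardsT addn1 ltnS.
have FE : F = sum_set [set a | inl a \in F]%SET [set b | inr b \in F]%SET.
  by apply/setP => -[x|x]; rewrite !inE.
move: fS SF; rewrite FE (node_setE S) (negPf nS).
rewrite face_node_set carried_node_set card_node_set card_sum_set.
move=> /and3P[fA fB _] /and3P[_ AF BF].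
by rewrite add0n leq_add ?IHl ?IHr.
Qed.

(** * The h-polynomial as a sum of face weights *)

Definition weight (d k : nat) : {poly int} := 'X^k * (1 - 'X) ^+ (d - k).

(** Multiplicativity under joins; the bounds keep the subtractions in [nat] from truncating. *)
Lemma weightM d k d' k' : (k <= d)%N -> (k' <= d')%N ->
  weight d k * weight d' k' = weight (d + d') (k + k').
Proof.
move=> kd kd'; rewrite /weight mulrACA -!exprD; congr (_ * _ ^+ _); lia.
Qed.

(** Coning preserves the h-polynomial: a face and its join with the apex together weigh as much as
    the face did in the base. *)
Lemma weightS d k : (k <= d)%N -> weight d.+1 k + weight d.+1 k.+1 = weight d k.
Proof.
move=> kd; rewrite /weight subSS subSn // !exprSr; ring.
Qed.

Lemma hpolyE (W : finType) d (D : {set {set W}}) :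
  (forall S, S \in D -> (#|S| <= d)%N) ->
  hpoly d D = \sum_(S in D) weight d #|S|.
Proof.
move=> Dd.
(* Faces are grouped by cardinality; the bound [Dd] ensures that [inord] never falls back to its
   default. *)
rewrite [RHS](partition_big (fun S : {set W} => inord #|S| : 'I_d.+1) xpredT) //=.
apply: eq_bigr => i _; rewrite /nfaces -sum1_card natr_sum -mulrA mulr_suml.
apply: eq_big => [S|S]; rewrite inE; last by move=> /andP[_ /eqP->]; rewrite mul1r.
case: (boolP (S \in D)) => //= SD.
by rewrite -val_eqE /= inordK // ltnS Dd.
Qed.

Definition h_face t (F : {set leaves t}) : {poly int} :=
  \sum_(S | face S && carried F S) weight #|F| #|S|.

Definition h_full t : {poly int} := h_face [set: leaves t]%SET.

Definition local_h t : {poly int} :=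
  \sum_(F : {set leaves t}) (-1) ^+ (#|leaves t| - #|F|) * h_face F.

(** * Recursions for the h-polynomial and the local h-polynomial *)

Lemma face_setU1_root t (S : {set nodes t}) : face S -> face (None |: S).
Proof.
move=> /faceP fS; apply/faceP => u w.
rewrite !inE => /predU1P[->|uS] /predU1P[->|wS]; rewrite ?sibling_rootl ?sibling_rootr //.
exact: fS.
Qed.

Lemma face_setD1_root t (S : {set nodes t}) : face S -> face (S :\ None).
Proof.
move=> /faceP fS; apply/faceP => u w; rewrite !inE => /andP[_ uS] /andP[_ wS].
exact: fS.
Qed.

(** The root has no sibling, so the complex is a cone with the root as apex. *)
Lemma big_face_root t (f : {set nodes t} -> {poly int}) :
  \sum_(S | face S) f S =
  \sum_(S | face S && (None \notin S)) (f S + f (None |: S)%SET).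
Proof.
rewrite big_split /= (bigID (fun S : {set nodes t} => None \notin S)) /=; congr (_ + _).
rewrite (reindex_onto (fun S => None |: S)%SET (fun S => S :\ None)%SET) /=; last first.
  by move=> S /andP[_]; rewrite negbK => /setD1K.
apply: eq_bigl => S; rewrite setU11 /= andbT.
apply/andP/andP => [[fS /eqP SE]|[fS nS]].
  split; first by rewrite -SE; exact: face_setD1_root.
  by rewrite -SE !inE.
by rewrite face_setU1_root // setU1K.
Qed.

Lemma card_face_noroot t (S : {set nodes t}) :
  face S -> None \notin S -> (#|S| <= #|leaves t|.-1)%N.
Proof. by move=> /card_face + /negPf nS; rewrite nS addn0; lia. Qed.

Lemma card_leaves_gt0 t : (0 < #|leaves t|)%N.
Proof. by have [v _] := under_nonempty (None : nodes t); apply/card_gt0P; exists v. Qed.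

Lemma h_fullE t :
  h_full t =
  \sum_(S : {set nodes t} | face S && (None \notin S)) weight #|leaves t|.-1 #|S|.
Proof.
rewrite /h_full /h_face; under eq_bigl do rewrite carriedT andbT.
rewrite cardsT big_face_root; apply: eq_bigr => S /andP[fS nS].
by rewrite cardsU1 nS -{1 2}(prednK (card_leaves_gt0 t)) weightS // card_face_noroot.
Qed.

Lemma h_full_leaf : h_full Leaf = 1.
Proof.
rewrite h_fullE (big_pred1 set0) => [|S /=].
  by rewrite card_unit cards0 /weight expr0 mulr1.
apply/andP/eqP => [[_ nS]|->]; last first.
  by rewrite inE; split=> //; apply/faceP => u w; rewrite inE.
by apply/setP => -[[]|]; rewrite (negPf nS) inE.
Qed.

(** After removal of the apex, a rootless pair [A], [B] is completed by neither subtree root, the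
    left one or the right one. These two isolated points have h-polynomial [1 + 'X]. *)
Lemma h_full_node l r : h_full (Node l r) = (1 + 'X) * h_full l * h_full r.
Proof.
rewrite h_fullE big_node_set big_bool /= big1 ?add0r; last first.
  by move=> A _; rewrite big_pred0 // => B; rewrite !inE andbF.
pose d := #|leaves (Node l r)|.-1.
(* Extension by zero to the forbidden pairs lets [A] and [B] range independently, so that
   [big_face_root] applies to each. *)
pose phi (A : {set nodes l}) (B : {set nodes r}) :=
  if ~~ ((None \in A) && (None \in B)) then weight d (#|A| + #|B|) else 0.
transitivity (\sum_(A | face A) \sum_(B | face B) phi A B).
  rewrite [RHS]big_mkcond; apply: eq_bigr => A _.
  under eq_bigl do rewrite face_node_set inE andbT.
  case: (face A) => /=; last by rewrite big_pred0.
  by rewrite big_mkcondr; apply: eq_bigr => B _; rewrite card_node_set.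
rewrite big_face_root -mulrA !h_fullE big_distrlr /= mulr_sumr.
apply: eq_bigr => A /andP[fA nA]; rewrite -big_split /= big_face_root mulr_sumr.
apply: eq_bigr => B /andP[fB nB].
have cA := card_face_noroot fA nA; have cB := card_face_noroot fB nB.
rewrite /phi !setU11 (negPf nA) (negPf nB) !cardsU1 nA nB /= !add1n addnS addSn addr0.
rewrite weightM // mulrDl mul1r /d card_leaves_node.
have -> : ((#|leaves l| + #|leaves r|).-1 = (#|leaves l|.-1 + #|leaves r|.-1).+1)%N.
  have := card_leaves_gt0 l; have := card_leaves_gt0 r; lia.
by rewrite weightS ?leq_add // /weight subSS exprS -mulrA.
Qed.

(** On a proper face the root is absent and the two subtree roots cannot both be carried, so the
    restriction is a join. On the full face, [1 + 'X] from [h_full_node] splits into the join term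
    and the correction. *)
Lemma h_face_node l r (F1 : {set leaves l}) (F2 : {set leaves r}) :
  h_face (t := Node l r) (sum_set F1 F2) =
  h_face F1 * h_face F2 +
  (if sum_set F1 F2 == [set: leaves l + leaves r]%SET
   then 'X * h_full l * h_full r else 0).
Proof.
case: eqP => [F12|/eqP F12].
  have := F12 => /eqP; rewrite sum_set_eqT => /andP[/eqP F1T /eqP F2T].
  rewrite F12 F1T F2T.
  rewrite -[LHS]/(h_full (Node l r)) h_full_node -/(h_full l) -/(h_full r); ring.
rewrite addr0 /h_face big_node_set big_bool /= big1 ?add0r; last first.
  move=> A _; rewrite big_pred0 // => B.
  by rewrite carried_node_set (negPf F12) andbF.
rewrite big_distrlr /= [RHS]big_mkcond; apply: eq_bigr => A _.
under eq_bigl do rewrite face_node_set carried_node_set /=.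
case: (boolP (face A && carried F1 A)) => [/andP[fA AF]|fA]; last first.
  rewrite big_pred0 // => B.
  by apply/negP => /andP[/and3P[a _ _] /andP[b _]]; rewrite a b in fA.
apply: eq_big => B; rewrite ?fA ?AF /=.
  case: (boolP (face B)) => //= fB.
  case: (boolP (carried F2 B)) => BF; rewrite ?andbF // andbT.
  apply: contra F12 => /andP[nA nB]; rewrite sum_set_eqT.
  by rewrite (carried_root nA AF) (carried_root nB BF) !eqxx.
move=> /andP[/andP[fB _] BF].
by rewrite weightM ?card_carried // card_node_set card_sum_set.
Qed.

(** Codimensions add, so the signs multiply and the join terms factor; the correction occurs only at
    the full face, with sign one. *)
Lemma local_h_node l r :
  local_h (Node l r) = local_h l * local_h r + 'X * h_full l * h_full r.
Proof.
rewrite /local_h (@big_sum_set _ (leaves l) (leaves r)).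
under eq_bigr => F1 _ do under eq_bigr => F2 _ do rewrite h_face_node mulrDr.
under eq_bigr do rewrite big_split; rewrite big_split /=; congr (_ + _).
  rewrite big_distrlr /=; apply: eq_bigr => F1 _; apply: eq_bigr => F2 _.
  rewrite mulrACA -exprD card_leaves_node card_sum_set; congr (_ ^+ _ * _).
  by rewrite subnDA addnC -addnBA ?max_card // addnC addnBA ?max_card.
rewrite (bigD1 [set: leaves l]%SET) //= [X in _ + X]big1 ?addr0; last first.
  move=> F1 /negPf F1T; apply: big1 => F2 _.
  by rewrite sum_set_eqT F1T mulr0.
rewrite (bigD1 [set: leaves r]%SET) //= big1 ?addr0; last first.
  by move=> F2 /negPf F2T; rewrite sum_set_eqT F2T andbF mulr0.
by rewrite sum_set_eqT !eqxx card_sum_set card_sum !cardsT subnn expr0 mul1r.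
Qed.

Lemma local_h_leaf : local_h Leaf = 0.
Proof.
rewrite /local_h (bigD1 [set: leaves Leaf]%SET) //= (big_pred1 set0) => [|F].
  rewrite cardsT cards0 card_unit subnn subn0 expr0 expr1 mul1r mulN1r.
  rewrite -/(h_full Leaf) h_full_leaf /h_face (big_pred1 set0) => [|S].
    by rewrite !cards0 /weight subnn !expr0 mulr1 subrr.
  apply/andP/eqP => [[_ /carriedP S0]|->].
    apply/setP => w; rewrite inE; apply/negP => wS.
    by have := S0 w tt wS isT; rewrite inE.
  by split; [apply/faceP | apply/carriedP] => w u; rewrite inE.
apply/idP/eqP => [FT|->].
  apply/setP => -[]; rewrite [RHS]inE; apply: contraNF FT => tF.
  by apply/eqP/setP => -[]; rewrite tF inE.
by apply/negP => /eqP/setP/(_ tt); rewrite !inE.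
Qed.

End Counting.

(** * The caterpillar with four cherries and its non-real root *)

Section Example.
Variable R : realType.
Local Open Scope ring_scope.

Lemma restrictionE t (F : {set leaves t}) :
  restriction (tree_triangulation R t) F = [set S in faces t | carried F S]%SET.
Proof.
apply/setP => S; rewrite !inE; congr andb.
by apply/asboolP/carriedP => /hull_sub_cornerP.
Qed.

Lemma local_hpoly_tree t : local_hpoly (tree_triangulation R t) = local_h t.
Proof.
apply: eq_bigr => F _; rewrite restrictionE hpolyE.
  by congr (_ * _); apply: eq_bigl => S; rewrite !inE.
by move=> S; rewrite !inE => /andP[]; apply: card_carried.
Qed.

Definition cherry : tree := Node Leaf Leaf.

Definition caterpillar : tree := Node (Node (Node cherry cherry) cherry) cherry.

Lemma card_caterpillar : #|leaves caterpillar| = 8.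
Proof. by rewrite !card_leaves_node card_unit. Qed.

(** With [a = (1 + 'X) ^+ 2], the recursion unrolls to ['X] times the geometric sum [a ^+ 3 + a ^+ 2
    * 'X + a * 'X ^+ 2 + 'X ^+ 3], which factors as [(a + 'X) * (a ^+ 2 + 'X ^+ 2)]. *)
Lemma local_h_caterpillar :
  local_h caterpillar =
  'X * ((1 + 'X) ^+ 2 + 'X) * ((1 + 'X) ^+ 4 + 'X ^+ 2) :> {poly int}.
Proof.
rewrite !(local_h_node, h_full_node) local_h_leaf h_full_leaf; ring.
Qed.

Lemma quartic_root :
  exists z : R[i], (1 + z) ^+ 4 + z ^+ 2 = 0.
Proof.
(* The list holds the negated lower coefficients of the expanded quartic, constant term first. *)
have [z zE] := @solve_monicpoly R[i] 4 (fun i => nth 0 [:: -1; -4; -7; -4] i) isT.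
exists z.
have -> : (1 + z) ^+ 4 + z ^+ 2 = z ^+ 4 + 4 * z ^+ 3 + 7 * z ^+ 2 + 4 * z + 1 by ring.
by rewrite zE !big_ord_recl big_ord0 /=; ring.
Qed.

(** At a real number the quartic is a sum of two squares, whose bases [1 + a] and [a] cannot both
    vanish. *)
Lemma quartic_root_nonreal (z : R[i]) :
  (1 + z) ^+ 4 + z ^+ 2 = 0 -> complex.Im z <> 0.
Proof.
case: z => a b /= + b0; rewrite b0.
have -> : (a +i* 0)%C = a%:C%C by [].
rewrite -(rmorph1 (real_complex R)) -rmorphD -!rmorphXn -rmorphD => /complexI /eqP.
rewrite -[4%N]/(2 * 2)%N exprM paddr_eq0 ?sqr_ge0 // !sqrf_eq0 => /andP[+ /eqP a0].
by rewrite a0 addr0 oner_eq0.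
Qed.

End Example.

Theorem theorem1p3 (R : realType) :
  exists (V : finType) (G : triangulation R V),
    [/\ #|V| = 8, flag (tri_faces G) & ~ real_rooted R (local_hpoly G)].
Proof.
exists (leaves caterpillar), (tree_triangulation R caterpillar); split.
- exact: card_caterpillar.
- exact: faces_flag.
have [z z0] := quartic_root R.
rewrite local_hpoly_tree local_h_caterpillar => -[|allreal]; last first.
  apply: (quartic_root_nonreal z0); apply: allreal.
  rewrite rmorphM rootM; apply/orP; right.
  by rewrite /root rmorphD !rmorphXn rmorphD rmorph1 /= map_polyX !hornerE z0.
(* The polynomial is nonzero: its value at 1 is [1 * 5 * 17]. *)
by move/(congr1 (horner^~ 1%R)); rewrite !hornerE.
Qed.
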